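(* The following statements hold for the Riemann surfaces $\varSigma$ and $\varSigma_1$ defined in the context. (i) The elliptic moduli $k$ of $\varSigma$ and $k_1$ of $\varSigma_1$ satisfy $k_1=\dfrac{1-k}{1+k}$. (ii) There is a holomorphic map $\varphi\colon\varSigma\to\varSigma_1$ given by $$\varSigma\ni(x,w)\mapsto(\lambda,\mu):=\left(\mathrm{i}(1+k)\frac{x}{w},\ \frac{k^2x^4-1}{w^2}\right)\in\varSigma_1 .$$ (iii) Under the map $\varphi$ of (ii), the points at infinity of $\varSigma$ are mapped to $\mathbf{o}_1:=(0,1)$; the points $(0,\pm1)$ are mapped to $\mathbf{o}_2:=(0,-1)$; the points $(\pm1,0)$ are mapped to $\infty_1$; and the points $(\pm1/k,0)$ are mapped to $\infty_2$. (iv) The holomorphic forms of the two surfaces are related by $$\varphi^*\left(\frac{d\lambda}{\mu}\right)=-\mathrm{i}(1+k)\frac{dx}{w}.$$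
   Context: Let $a,A,B\in\mathbb{C}$ with $a\neq0$, $B\neq0$ and $A^2\neq4a^2B$ (in the paper $A=x^2-2ay$ and $B=y^2+z^2$ are the integrals of motion of the system $\dot x=-2az$, $\dot y=-2xz$, $\dot z=2xy$). Let $\pm x_1,\pm x_2$ be the zeros of $p(x)=x^4-2Ax^2+A^2-4a^2B$, with $x_1^2=A+2a\sqrt B$ and $x_2^2=A-2a\sqrt B$. Let $\pm\lambda_1,\pm\lambda_2$ be the zeros of $p_1(\lambda)=a^2\lambda^4-A\lambda^2+B$, i.e. $\lambda_1^2=\frac{A+\sqrt{A^2-4a^2B}}{2a^2}$, $\lambda_2^2=\frac{A-\sqrt{A^2-4a^2B}}{2a^2}$, the branches and signs of the roots being chosen so that $\lambda_1=\frac{x_2-x_1}{2a}$ and $\lambda_2=\frac{x_1+x_2}{2a}$. Put $k=x_1/x_2$ and $k_1=\lambda_1/\lambda_2$. $\varSigma$ is the compact Riemann surface of the equation $w^2=(1-x^2)(1-k^2x^2)$ (including its two points at infinity), and $\varSigma_1$ is the compact Riemann surface of the equation $\mu^2=(1-\lambda^2)(1-k_1^2\lambda^2)$, including its two points at infinity $\infty_1,\infty_2$, where $\infty_1$ is the one near which $\mu\sim k_1\lambda^2$ (and $\mu\sim-k_1\lambda^2$ near $\infty_2$). The numbers $k$ and $k_1$ are called the elliptic moduli of $\varSigma$ and $\varSigma_1$. *)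

(* Defs.v *)
From HB Require Import structures.
From mathcomp Require Import all_boot all_order all_algebra.
From mathcomp Require Import all_classical all_reals all_analysis.
From mathcomp Require Import complex ring.

Set Implicit Arguments.
Unset Strict Implicit.
Unset Printing Implicit Defensive.

Import Order.TTheory GRing.Theory Num.Theory.
Import numFieldNormedType.Exports.

Local Open Scope classical_set_scope.
Local Open Scope ring_scope.

(* The field of complex numbers over a model R of the real numbers. Going
   through numClosedFieldType gives R[i] its norm topology, for which
   [derivable f z 1] is complex differentiability. *)
Definition Cplx (R : realType) : numClosedFieldType := R[i].

Section RiemannSurfaces.
Variable C : numClosedFieldType.

(* A chart is a homeomorphism cmap from an open set cdom onto an open set of C;
   cinv is its inverse, with irrelevant values outside the image of cmap. *)
Record chart (T : topologicalType) := Chart {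
  cdom : set T;
  cmap : T -> C;
  cinv : C -> T;
  cdom_open : open cdom;
  cimg_open : open (cmap @` cdom);
  cmapK : forall p, cdom p -> cinv (cmap p) = p;
  cmap_cont : forall p, cdom p -> {for p, continuous cmap};
  cinv_cont : forall z, (cmap @` cdom) z -> {for z, continuous cinv} }.

Definition cimg (T : topologicalType) (c : chart T) : set C := cmap c @` cdom c.

Record surface := Surface {
  space :> topologicalType;
  atlas : set (chart space) }.
Arguments atlas : clear implicits.

Definition read (X Y : surface) (phi : X -> Y) (c : chart X) (d : chart Y)
  : C -> C := cmap d \o phi \o cinv c.

Definition holomorphic (X Y : surface) (phi : X -> Y) : Prop :=
  continuous phi /\
  forall c d z, atlas X c -> atlas Y d -> cimg c z ->
    cdom d (phi (cinv c z)) -> derivable (read phi c d) z 1.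

(* No second countability axiom: it follows from the others (Rado). *)
Definition riemann_surface (X : surface) : Prop :=
  [/\ hausdorff_space X, connected [set: X],
      (forall p : X, exists2 c, atlas X c & cdom c p) &
      holomorphic (@id X)].

(* A differential 1-form f(z) dz, given by its coefficient f in each chart. *)
Definition form (X : surface) := chart X -> C -> C.

(* [is_pullback phi eta omega] means omega = phi^* eta. *)
Definition is_pullback (X Y : surface) (phi : X -> Y)
    (eta : form Y) (omega : form X) : Prop :=
  forall c d z, atlas X c -> atlas Y d -> cimg c z ->
    cdom d (phi (cinv c z)) ->
    omega c z = eta d (read phi c d z) * 'D_1 (read phi c d) z.

(* The coefficients are holomorphic and agree on overlaps of charts. *)
Definition holomorphic_form (X : surface) (omega : form X) : Prop :=
  (forall c z, atlas X c -> cimg c z -> derivable (omega c) z 1) /\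
  is_pullback (@id X) omega omega.

Definition scale_form (X : surface) (a : C) (omega : form X) : form X :=
  fun c z => a * omega c z.

End RiemannSurfaces.

Section LegendreCurve.
Variables (C : numClosedFieldType) (k : C).

(* The curve w^2 = (1 - x^2)(1 - k^2 x^2) has two points at infinity. In the
   coordinates u = 1/x, v = w/x^2 it reads v^2 = (u^2 - 1)(u^2 - k^2), and the
   points at infinity are (u, v) = (0, k) and (u, v) = (0, -k). *)
Definition legendre : {poly C} := (1 - 'X^2) * (1 - (k ^+ 2)%:P * 'X^2).
Definition legendre_inf : {poly C} := ('X^2 - 1) * ('X^2 - (k ^+ 2)%:P).

Definition curve : Type :=
  ({p : C * C | p.2 ^+ 2 == legendre.[p.1]} + bool)%type.

(* w ~ k x^2 near infty1, and w ~ - k x^2 near infty2. *)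
Definition infty1 : curve := inr true.
Definition infty2 : curve := inr false.

Definition xw (p : curve) : option (C * C) :=
  if p is inl q then Some (val q) else None.

Definition uv (p : curve) : option (C * C) :=
  match p with
  | inl q => let: (x, w) := val q in
             if x == 0 then None else Some (x^-1, w / x ^+ 2)
  | inr s => Some (0, if s then k else - k)
  end.

(* The topology glued from the subspace topologies of the two plane curves. *)
Definition patch_open (f : curve -> option (C * C)) (A : set curve) : Prop :=
  exists U : set (C * C),
    open U /\ forall p z, f p = Some z -> (A p <-> U z).

Definition curve_open (A : set curve) : Prop :=
  patch_open xw A /\ patch_open uv A.

HB.instance Definition _ := Choice.copy curve
  ({p : C * C | p.2 ^+ 2 == legendre.[p.1]} + bool)%type.

Let patch_openT f : patch_open f setT.
Proof. by exists setT; split => //; exact: openT. Qed.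

Let patch_openI f : setI_closed (patch_open f).
Proof.
move=> A B [U [oU hU]] [V [oV hV]]; exists (U `&` V).
split; first exact: openI.
by move=> p z e; rewrite /setI /= (hU p z e) (hV p z e).
Qed.

Let patch_open_bigU f (I : Type) (A : I -> set curve) :
  (forall i, patch_open f (A i)) -> patch_open f (\bigcup_i A i).
Proof.
move=> /choice[U hU]; exists (\bigcup_i U i); split.
  by apply: bigcup_open => i _; case: (hU i).
by move=> p z e; split => -[i _ hi]; exists i => //;
  have [_ /(_ p z e)[]] := hU i; auto.
Qed.

Let curve_openT : curve_open setT. Proof. by split; exact: patch_openT. Qed.

Let curve_openI : setI_closed curve_open.
Proof. by move=> A B [? ?] [? ?]; split; exact: patch_openI. Qed.

Let curve_open_bigU (I : Type) (A : I -> set curve) :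
  (forall i, curve_open (A i)) -> curve_open (\bigcup_i A i).
Proof. by move=> h; split; apply: patch_open_bigU => i; case: (h i). Qed.

HB.instance Definition _ :=
  isOpenTopological.Build curve curve_openT curve_openI curve_open_bigU.

(* Coordinate functions, with the irrelevant value 0 outside their patch. *)
Definition xC (p : curve) : C := if xw p is Some z then z.1 else 0.
Definition wC (p : curve) : C := if xw p is Some z then z.2 else 0.
Definition uC (p : curve) : C := if uv p is Some z then z.1 else 0.
Definition vC (p : curve) : C := if uv p is Some z then z.2 else 0.

(* x is a local coordinate where w <> 0, w where d(w^2)/dx <> 0, and u where
   v <> 0, in particular at infinity. *)
Definition curve_atlas : set (chart C curve) :=
  [set c |
    (forall p, cdom c p -> [/\ xw p : bool, wC p != 0 & cmap c p = xC p]) \/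
    (forall p, cdom c p ->
       [/\ xw p : bool, legendre^`().[xC p] != 0 & cmap c p = wC p]) \/
    (forall p, cdom c p -> [/\ uv p : bool, vC p != 0 & cmap c p = uC p])].

Definition Sigma : surface C := Surface curve_atlas.

(* The form dx/w, read as 2 dw / (d(w^2)/dx) where w = 0 and as - du/v at
   infinity. *)
Definition dx_over_w : form Sigma := fun c z =>
  let p := cinv c z in
  match xw p with
  | Some (x, w) =>
      if w == 0 then 2 * 'D_1 (wC \o cinv c) z / legendre^`().[x]
      else 'D_1 (xC \o cinv c) z / w
  | None => - 'D_1 (uC \o cinv c) z / vC p
  end.

End LegendreCurve.

(* Main.v *)
(* On the affine parts, (1 - lambda^2) w^2 = (1 + k x^2)^2 and
   (1 - k1^2 lambda^2) w^2 = (1 - k x^2)^2, so (x, w) |-> (lambda, mu) lands on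
   the second curve. It extends over w = 0 and over infinity because
   1/lambda = w / (i (1 + k) x), mu/lambda^2 = (1 - k^2 x^4) / ((1 + k) x)^2
   are regular where x <> 0, and in the coordinates u = 1/x, v = w/x^2
   lambda = i (1 + k) u/v, mu = (k^2 - u^4) / v^2 are regular where v <> 0.
   Holomorphy and pullbacks are tested along maps g : C -> curve; a chart c is
   the case g = cinv c, and phi read in c is the case g = phi \o cinv c. Along
   such a g, the value f of dx/w satisfies x' = f w and w' = f P'(x) / 2, where
   w^2 = P(x), and part (iv) is the computation of the same two derivatives for
   (lambda, mu). *)
Require Import Defs.
From mathcomp Require Import all_boot all_order all_algebra.
From mathcomp Require Import all_classical all_reals all_analysis.
From mathcomp Require Import ring.
Set Implicit Arguments.
Unset Strict Implicit.
Unset Printing Implicit Defensive.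

Import Order.TTheory GRing.Theory Num.Theory.
Import numFieldNormedType.Exports.
Local Open Scope ring_scope.
Local Open Scope classical_set_scope.

(** * Derivatives and continuity in one variable *)

Section OneVariable.
Context {K : numFieldType}.
Implicit Types (f g : K -> K) (z : K).

Lemma near_is_derive f g z df :
  (\near z, f z = g z) -> is_derive z 1 f df -> is_derive z 1 g df.
Proof.
move=> e [df1 <-]; split; first exact: near_eq_derivable df1.
by rewrite -(near_eq_derive _ e).
Qed.

Lemma derivable1_continuous f z : derivable f z 1 -> {for z, continuous f}.
Proof. by move=> /derivable1_diffP /differentiable_continuous. Qed.

Lemma is_derive_chain f g z a b :
  is_derive (g z) 1 f a -> is_derive z 1 g b -> is_derive z 1 (f \o g) (a * b).
Proof.
move=> [/derivable1_diffP df <-] [/derivable1_diffP dg <-].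
have dfg : differentiable (f \o g) z by exact: differentiable_comp.
split; first exact/derivable1_diffP.
rewrite !deriveE // diff_comp //=.
(* The value ['d g z 1] is a scalar; written as a multiple of 1, it comes out of the linear map
   ['d f (g z)]. *)
rewrite -[X in 'd f _ X]mulr1 -[X in 'd f _ X]/('d g z 1 *: 1) linearZ /=.
by rewrite mulrC.
Qed.

Lemma is_derive_Ml (c : K) f z df :
  is_derive z 1 f df -> is_derive z 1 (fun z => c * f z) (c * df).
Proof. exact: is_deriveZ. Qed.

Lemma is_derive_div f g z df dg :
  is_derive z 1 f df -> is_derive z 1 g dg -> g z != 0 ->
  is_derive z 1 (fun z => f z / g z) ((df * g z - f z * dg) / g z ^+ 2).
Proof.
move=> [df1 <-] [dg1 <-] g0.
have dgV : derivable (fun z => (g z)^-1) z 1 by exact: derivableV.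
split; first exact: (derivableM df1 dgV).
rewrite (deriveM df1 dgV) deriveV // /GRing.scale /=.
by field.
Qed.

Lemma continuous_hornerp (p : {poly K}) : continuous (horner p).
Proof.
elim/poly_ind: p => [|p c ih].
  have -> : horner (0 : {poly K}) = cst 0 by apply: funext => x; rewrite horner0.
  exact: cst_continuous.
have -> : horner (p * 'X + c%:P) = (fun x => p.[x] * x + c).
  by apply: funext => x; rewrite !hornerE.
move=> z /=; apply: (@cvgD _ _ _ (nbhs z)); last exact: cvg_cst.
by apply: cvgM; [exact: ih|exact: cvg_id].
Qed.

(** The chain rule for polynomials. Numerators and denominators below are written as values of
    polynomials, even plain powers such as ['X^2.[_]], so that this lemma and
    [continuous_horner_comp] cover them. *)
Lemma is_derive_horner (p : {poly K}) f z df :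
  is_derive z 1 f df -> is_derive z 1 (fun z => p.[f z]) (p^`().[f z] * df).
Proof.
move=> hf; elim/poly_ind: p => [|p c ih].
  rewrite deriv0 !horner0 mul0r.
  by apply: (@near_is_derive (cst 0)); near=> y; rewrite horner0.
apply: (@near_is_derive ((fun z => p.[f z]) * f + cst c)).
  by near=> y; rewrite !hornerE.
apply: is_derive_eq.
rewrite derivD derivC addr0 derivM derivX !hornerE /= /GRing.scale /=.
by ring.
Unshelve. all: by end_near.
Qed.

Section Continuity.
Context {T : topologicalType}.
Implicit Types (a b : T -> K) (t : T).

Lemma continuous_Ml (c : K) a t :
  {for t, continuous a} -> {for t, continuous (fun t => c * a t)}.
Proof. by move=> ca; apply: cvgM => //; exact: cvg_cst. Qed.

Lemma continuous_div a b t :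
  {for t, continuous a} -> {for t, continuous b} -> b t != 0 ->
  {for t, continuous (fun t => a t / b t)}.
Proof. by move=> ca cb b0; apply: cvgM => //; exact: cvgV. Qed.

Lemma continuous_horner_comp (p : {poly K}) a t :
  {for t, continuous a} -> {for t, continuous (fun t => p.[a t])}.
Proof. by move=> ca; apply: continuous_comp => //; exact: continuous_hornerp. Qed.

End Continuity.

(* Factoring p - p.[f z] = ('X - (f z)) * q turns the difference quotient of f
   into that of g divided by q.[f _], and q.[f z] = p'.[f z] <> 0. *)
Lemma derivable_implicit (p : {poly K}) f g z :
  {for z, continuous f} -> (\near z, p.[f z] = g z) -> derivable g z 1 ->
  p^`().[f z] != 0 -> derivable f z 1.
Proof.
move=> cf e dg p'0.
have /factor_theorem[q pE] : root (p - (p.[f z])%:P) (f z).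
  by rewrite rootE !hornerE subrr.
have q0 : q.[f z] = p^`().[f z].
  have -> : p = q * ('X - (f z)%:P) + (p.[f z])%:P by rewrite -pE subrK.
  by rewrite derivD derivC addr0 derivM derivXsubC mulr1 !hornerE subrr mulr0 add0r.
have cs : (fun h : K => h *: (1 : K) + z) @ 0 --> z.
  rewrite -[X in _ --> X]add0r -[X in _ --> X + _](scale0r (1 : K)).
  apply: (@cvgD _ _ _ (nbhs (0 : K))); last exact: cvg_cst.
  by apply: cvgZr_tmp; exact: cvg_id.
have cq : (fun h : K => q.[f (h *: 1 + z)]) @ 0^' --> q.[f z].
  apply: cvg_within_filter.
  apply: continuous_cvg; first exact: continuous_hornerp.
  by apply: continuous_cvg.
have /cvg_ex[/= l dl] := dg.
apply/cvg_ex; exists (l * q.[f z]^-1).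
have : (fun h : K => (h^-1 *: ((g \o shift z) (h *: 1) - g z)) *
      (q.[f (h *: 1 + z)])^-1) @ 0^' --> l * q.[f z]^-1.
  by apply: cvgM => //; apply: cvgV => //; rewrite q0.
apply: cvg_trans; apply: near_eq_cvg.
have ne := nbhs_singleton e.
have n1 : \forall h \near 0^', p.[f (h *: 1 + z)] = g (h *: 1 + z).
  by apply: cvg_within; exact: (cs _ e).

have n2 : \forall h \near 0^', q.[f (h *: 1 + z)] != 0.
  by apply: (cvgr_neq0 _ cq); rewrite q0.
near=> h.
have h0 : q.[f (h *: 1 + z)] != 0 by near: h.
have h1 : p.[f (h *: 1 + z)] = g (h *: 1 + z) by near: h.
have := congr1 (horner ^~ (f (h *: 1 + z))) pE.
rewrite /= !hornerE h1 ne => ->.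
by rewrite /= -scalerAl mulrAC mulfV // mul1r.
Unshelve. all: by end_near.
Qed.

End OneVariable.

(** * The two affine patches and the topology of the curve *)

Section Curve.
Context {C : numClosedFieldType} {k : C}.
Local Notation P := (legendre k).
Local Notation Q := (legendre_inf k).
Local Notation curve := (curve k).
Implicit Types (p q : curve) (x w u v z : C).

Lemma legendreE x : P.[x] = (1 - x ^+ 2) * (1 - k ^+ 2 * x ^+ 2).
Proof. by rewrite /legendre !hornerE. Qed.

Lemma legendre_infE u : Q.[u] = (u ^+ 2 - 1) * (u ^+ 2 - k ^+ 2).
Proof. by rewrite /legendre_inf !hornerE. Qed.

Lemma deriv_legendreE x :
  P^`().[x] = 2 * x * (2 * k ^+ 2 * x ^+ 2 - 1 - k ^+ 2).
Proof.
rewrite /legendre !(derivM, derivB, derivXn, derivX, derivC) !hornerE /= ?derivX ?hornerE.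
by ring.
Qed.

Lemma xw_eq p x w : xw p = Some (x, w) -> w ^+ 2 = P.[x].
Proof. by case: p => //= -[[x' w'] /= /eqP e] [<- <-]. Qed.

Lemma uv_eq p u v : uv p = Some (u, v) -> v ^+ 2 = Q.[u].
Proof.
case: p => [[[x w] /= /eqP e]|s [<- <-]]; last first.
  by rewrite legendre_infE; case: s; ring.
case: eqVneq => // x0 [<- <-].
by rewrite exprMn e legendreE legendre_infE; field.
Qed.

Lemma xw_uv p x w :
  xw p = Some (x, w) -> x != 0 -> uv p = Some (x^-1, w / x ^+ 2).
Proof. by case: p => //= -[[x' w'] /= e] [-> ->]; case: eqVneq. Qed.

Lemma uv_xw p u v :
  uv p = Some (u, v) -> u != 0 -> xw p = Some (u^-1, v / u ^+ 2).
Proof.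
case: p => [[[x w] /= e]|s [<-]]; last by rewrite eqxx.
case: eqVneq => // x0 [<- <-] _; rewrite invrK; congr (Some (_, _)).
by field.
Qed.

Lemma xw_none p : xw p = None -> exists2 v, uv p = Some (0, v) & v ^+ 2 = k ^+ 2.
Proof.
case: p => // s _; exists (if s then k else - k) => //.
by case: s; rewrite ?sqrrN.
Qed.

Lemma xwE p : xw p -> xw p = Some (xC p, wC p).
Proof. by rewrite /xC /wC; case: (xw p) => [[]|]. Qed.

Lemma uvE p : uv p -> uv p = Some (uC p, vC p).
Proof. by rewrite /uC /vC; case: (uv p) => [[]|]. Qed.

Lemma xCE p x w : xw p = Some (x, w) -> xC p = x.
Proof. by rewrite /xC => ->. Qed.

Lemma wCE p x w : xw p = Some (x, w) -> wC p = w.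
Proof. by rewrite /wC => ->. Qed.

Lemma uCE p u v : uv p = Some (u, v) -> uC p = u.
Proof. by rewrite /uC => ->. Qed.

Lemma vCE p u v : uv p = Some (u, v) -> vC p = v.
Proof. by rewrite /vC => ->. Qed.

(* Inversion of the first coordinate exchanges the two affine patches. *)
Definition swap (z : C * C) : C * C := (z.1^-1, z.2 / z.1 ^+ 2).

Lemma open_swap (U : set (C * C)) : open U -> open [set z : C * C | z.1 != 0 /\ U (swap z)].
Proof.
move=> oU; rewrite openE => -[a b] /= [a0 Uab]; rewrite /interior.
have ca : (fun z : C * C => z.1) @ (a, b) --> a by exact: cvg_fst.
have cb : (fun z : C * C => z.2) @ (a, b) --> b by exact: cvg_snd.
have cs : swap @ (a, b) --> swap (a, b).
  apply: (@cvg_pair _ _ _ _ (nbhs _) (nbhs _)); first exact: cvgV.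
  apply: (@cvgM _ _ (nbhs (a, b))) => //; apply: cvgV; first by rewrite expf_neq0.
  exact: (@cvgM _ _ (nbhs (a, b))).
have n1 : \forall z \near (a, b), z.1 != 0 by exact: (cvgr_neq0 _ ca).
have n2 : \forall z \near (a, b), U (swap z).
  by apply: cs; exact: open_nbhs_nbhs.
by near=> z; split; near: z.
Unshelve. all: by end_near.
Qed.

(** Openness has to be tested in both patches. In the patch at infinity the set is the preimage of
    [U] under [swap] on u <> 0, since the points with u = 0 are those at infinity. *)
Lemma open_xw (U : set (C * C)) :
  open U -> open [set p : curve | exists2 z, xw p = Some z & U z].
Proof.
move=> oU; split.
  by exists U; split=> // p z e; split=> [[y]|Uz]; [rewrite e => -[->]|exists z].
exists [set z : C * C | z.1 != 0 /\ U (swap z)]; split; first exact: open_swap.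
move=> p [u v] e /=; split=> [[[x w] exw Uz]|[u0 Uz]].
  have x0 : x != 0.
    apply: contra_eq_neq e => x0.
    by case: p exw => //= -[] /= [x' w'] _ [-> _]; rewrite x0 eqxx.
  move: (xw_uv exw x0); rewrite e => -[-> ->]; rewrite invr_eq0; split=> //.
  rewrite /swap /= invrK; move: Uz; by congr (U (_, _)); field.
by exists (swap (u, v)) => //; exact: uv_xw.
Qed.

Lemma open_uv (U : set (C * C)) :
  open U -> open [set p : curve | exists2 z, uv p = Some z & U z].
Proof.
move=> oU; split; last first.
  by exists U; split=> // p z e; split=> [[y]|Uz]; [rewrite e => -[->]|exists z].
exists [set z : C * C | z.1 != 0 /\ U (swap z)]; split; first exact: open_swap.
move=> p [x w] e /=; split=> [[z euv Uz]|[x0 Uz]].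
  have x0 : x != 0.
    apply: contra_eq_neq euv => x0.
    by case: p e => //= -[] /= [x' w'] _ [-> _]; rewrite x0 eqxx.
  by move: euv; rewrite (xw_uv e x0) => -[ez]; rewrite /swap /= ez.
by exists (swap (x, w)) => //; exact: xw_uv.
Qed.

Section Continuity.
Context {T : topologicalType}.
Implicit Types (g : T -> curve) (t : T).

(** An open set of the curve meets each patch in the trace of an open set of the plane, so a map
    that stays in one patch near t is continuous at t once its two coordinates there are. *)
Lemma continuous_patch (f : curve -> option (C * C)) g t (x w : T -> C) :
  (forall A, curve_open A -> patch_open f A) ->
  (\near t, f (g t) = Some (x t, w t)) ->
  {for t, continuous x} -> {for t, continuous w} -> {for t, continuous g}.
Proof.
move=> fo e cx cw A; rewrite nbhsE => -[B [oB Bgt] BA].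
have [U [oU hU]] := fo _ oB.
have c : (fun t => (x t, w t)) @ t --> (x t, w t).
  by apply: (@cvg_pair _ _ _ _ (nbhs _) (nbhs _)).
have n : \forall s \near t, U (x s, w s).
  by apply: c; apply: open_nbhs_nbhs; split=> //; exact/(hU _ _ (nbhs_singleton e)).
change (\forall s \near t, A (g s)).
near=> s; have es : f (g s) = Some (x s, w s) by near: s.
by apply: BA; apply/(hU _ _ es); near: s.
Unshelve. all: by end_near.
Qed.

Lemma continuous_xw g t (x w : T -> C) :
  (\near t, xw (g t) = Some (x t, w t)) ->
  {for t, continuous x} -> {for t, continuous w} -> {for t, continuous g}.
Proof. by apply: continuous_patch => A []. Qed.

Lemma continuous_uv g t (u v : T -> C) :
  (\near t, uv (g t) = Some (u t, v t)) ->
  {for t, continuous u} -> {for t, continuous v} -> {for t, continuous g}.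
Proof. by apply: continuous_patch => A []. Qed.

Lemma near_xw g t : {for t, continuous g} -> xw (g t) ->
  \near t, xw (g t) = Some (xC (g t), wC (g t)).
Proof.
move=> cg h; have : nbhs (g t) [set p : curve | exists2 z, xw p = Some z & setT z].
  apply: open_nbhs_nbhs; split; first by apply: open_xw; exact: openT.
  by exists (xC (g t), wC (g t)) => //; exact: xwE.
move=> /cg n; have {}n : \forall s \near t, exists2 z, xw (g s) = Some z & setT z by [].
by apply: filterS n => s [z e _]; apply: xwE; rewrite e.
Qed.

Lemma near_uv g t : {for t, continuous g} -> uv (g t) ->
  \near t, uv (g t) = Some (uC (g t), vC (g t)).
Proof.
move=> cg h; have : nbhs (g t) [set p : curve | exists2 z, uv p = Some z & setT z].
  apply: open_nbhs_nbhs; split; first by apply: open_uv; exact: openT.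
  by exists (uC (g t), vC (g t)) => //; exact: uvE.
move=> /cg n; have {}n : \forall s \near t, exists2 z, uv (g s) = Some z & setT z by [].
by apply: filterS n => s [z e _]; apply: uvE; rewrite e.
Qed.

End Continuity.

Lemma continuous_xC p : xw p -> {for p, continuous (@xC C k)}.
Proof.
move=> h A; rewrite nbhsE => -[B [oB Bp] BA].
apply: (@filterS _ _ _ [set p : curve | exists2 z, xw p = Some z & (B \o fst) z]).
  by move=> q [[x w] e /= Bz]; apply: BA; rewrite (xCE e).
apply: open_nbhs_nbhs; split; last by exists (xC p, wC p) => //; exact: xwE.
by apply: open_xw; apply: open_comp => // z _; exact: cvg_fst.
Qed.

Lemma continuous_wC p : xw p -> {for p, continuous (@wC C k)}.
Proof.
move=> h A; rewrite nbhsE => -[B [oB Bp] BA].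
apply: (@filterS _ _ _ [set p : curve | exists2 z, xw p = Some z & (B \o snd) z]).
  by move=> q [[x w] e /= Bz]; apply: BA; rewrite (wCE e).
apply: open_nbhs_nbhs; split; last by exists (xC p, wC p) => //; exact: xwE.
by apply: open_xw; apply: open_comp => // z _; exact: cvg_snd.
Qed.

Lemma continuous_uC p : uv p -> {for p, continuous (@uC C k)}.
Proof.
move=> h A; rewrite nbhsE => -[B [oB Bp] BA].
apply: (@filterS _ _ _ [set p : curve | exists2 z, uv p = Some z & (B \o fst) z]).
  by move=> q [[x w] e /= Bz]; apply: BA; rewrite (uCE e).
apply: open_nbhs_nbhs; split; last by exists (uC p, vC p) => //; exact: uvE.
by apply: open_uv; apply: open_comp => // z _; exact: cvg_fst.
Qed.

Lemma continuous_vC p : uv p -> {for p, continuous (@vC C k)}.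
Proof.
move=> h A; rewrite nbhsE => -[B [oB Bp] BA].
apply: (@filterS _ _ _ [set p : curve | exists2 z, uv p = Some z & (B \o snd) z]).
  by move=> q [[x w] e /= Bz]; apply: BA; rewrite (vCE e).
apply: open_nbhs_nbhs; split; last by exists (uC p, vC p) => //; exact: uvE.
by apply: open_uv; apply: open_comp => // z _; exact: cvg_snd.
Qed.

End Curve.

(** * Holomorphic maps from C to the curve, and dx/w along them *)

Section HolomorphicPaths.
Context {C : numClosedFieldType} {k : C}.
Hypotheses (k0 : k != 0) (k21 : k ^+ 2 != 1).
Local Notation P := (legendre k).
Local Notation curve := (curve k).
Implicit Types (g : C -> curve) (c d : chart C (Sigma k)) (z : C).

(** Both coordinates of each patch are tested, whether or not they are local parameters at [g z], so
    the definition needs no choice of chart. *)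
Definition hol_at g z : Prop :=
  [/\ {for z, continuous g},
      (xw (g z) -> derivable (@xC C k \o g) z 1 /\ derivable (@wC C k \o g) z 1) &
      (uv (g z) -> derivable (@uC C k \o g) z 1 /\ derivable (@vC C k \o g) z 1)].

(** For [g := cinv c] this is convertible to [dx_over_w c z]. *)
Definition dx_over_w_along g z : C :=
  match xw (g z) with
  | Some (x, w) =>
      if w == 0 then 2 * 'D_1 (@wC C k \o g) z / P^`().[x]
      else 'D_1 (@xC C k \o g) z / w
  | None => - 'D_1 (@uC C k \o g) z / vC (g z)
  end.

(** The roots of P are simple: the derivative is 2 x (k^2 - 1) where x^2 = 1 and 2 x (1 - k^2) where
    k^2 x^2 = 1. Hence w and P'(x) never vanish together on the affine curve. *)
Lemma deriv_legendre_neq0 x : P.[x] = 0 -> P^`().[x] != 0.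
Proof.
rewrite legendreE deriv_legendreE => /eqP; rewrite mulf_eq0 !subr_eq0.
have x0 : x ^+ 2 != 0 -> x != 0 by rewrite expf_eq0.
case/orP=> /eqP e.
  have -> : 2 * x * (2 * k ^+ 2 * x ^+ 2 - 1 - k ^+ 2) = 2 * x * (k ^+ 2 - 1).
    by rewrite -e; ring.
  by rewrite !mulf_neq0 ?subr_eq0 ?pnatr_eq0 // x0 // -e oner_eq0.
have -> : 2 * x * (2 * k ^+ 2 * x ^+ 2 - 1 - k ^+ 2) = 2 * x * (1 - k ^+ 2).
  by rewrite -[2 * k ^+ 2 * _]mulrA -e; ring.
rewrite !mulf_neq0 ?pnatr_eq0 ?subr_eq0 1?[1 == _]eq_sym // x0 //.
by apply: contra_eq_neq e => ->; rewrite mulr0 oner_eq0.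
Qed.

(** One patch suffices: where the other one also applies, x <> 0 and its coordinates are 1/x and
    w/x^2. *)
Lemma hol_at_xw g z (x w : C -> C) :
  (\near z, xw (g z) = Some (x z, w z)) ->
  derivable x z 1 -> derivable w z 1 -> hol_at g z.
Proof.
move=> e dx dw; have ez := nbhs_singleton e.
split.
- exact: continuous_xw e (derivable1_continuous dx) (derivable1_continuous dw).
- move=> _; split; [apply: near_eq_derivable dx|apply: near_eq_derivable dw].
    by apply: filterS e => y e /=; rewrite (xCE e).
  by apply: filterS e => y e /=; rewrite (wCE e).
- move=> h; have x0 : x z != 0.
    apply/eqP => x0; move: ez h; rewrite x0.
    by case: (g z) => //= -[[x' w'] ? /=] [-> _]; rewrite eqxx.
  have n0 : \near z, x z != 0 by exact: (cvgr_neq0 _ (derivable1_continuous dx)).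
  have e' : \near z, uv (g z) = Some ((x z)^-1, w z / x z ^+ 2).
    by near=> y; apply: xw_uv; near: y.
  split.
    apply: (@near_eq_derivable _ _ _ (fun y => (x y)^-1)).
      by apply: filterS e' => y {}e /=; rewrite (uCE e).
    exact: derivableV.
  apply: (@near_eq_derivable _ _ _ (w * (fun y => ((x ^+ 2) y)^-1))).
    by apply: filterS e' => y {}e /=; rewrite (vCE e).
  apply: derivableM => //; apply: derivableV; first exact: (expf_neq0 2 x0).
  exact: derivableX.
Unshelve. all: by end_near.
Qed.

Lemma hol_at_uv g z (u v : C -> C) :
  (\near z, uv (g z) = Some (u z, v z)) ->
  derivable u z 1 -> derivable v z 1 -> hol_at g z.
Proof.
move=> e du dv; have ez := nbhs_singleton e.
split.
- exact: continuous_uv e (derivable1_continuous du) (derivable1_continuous dv).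
- move=> h; have u0 : u z != 0.
    apply/eqP => u0; move: ez h; rewrite u0; case: (g z) => //= -[[x' w'] ? /=].
    by case: eqVneq => // x0 [/eqP]; rewrite invr_eq0 (negPf x0).
  have n0 : \near z, u z != 0 by exact: (cvgr_neq0 _ (derivable1_continuous du)).
  have e' : \near z, xw (g z) = Some ((u z)^-1, v z / u z ^+ 2).
    by near=> y; apply: uv_xw; near: y.
  split.
    apply: (@near_eq_derivable _ _ _ (fun y => (u y)^-1)).
      by apply: filterS e' => y {}e /=; rewrite (xCE e).
    exact: derivableV.
  apply: (@near_eq_derivable _ _ _ (v * (fun y => ((u ^+ 2) y)^-1))).
    by apply: filterS e' => y {}e /=; rewrite (wCE e).
  apply: derivableM => //; apply: derivableV; first exact: (expf_neq0 2 u0).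
  exact: derivableX.
- move=> _; split; [apply: near_eq_derivable du|apply: near_eq_derivable dv].
    by apply: filterS e => y e /=; rewrite (uCE e).
  by apply: filterS e => y e /=; rewrite (vCE e).
Unshelve. all: by end_near.
Qed.

(** These two equations treat both branches of [dx_over_w_along] alike. Differentiating w^2 = P(x)
    along g gives 2 w w' = P'(x) x'. Where w <> 0 this yields w' from x'; where w = 0 the root x is
    simple, which forces x' = 0. *)
Lemma is_derive_xw g z x w : hol_at g z -> xw (g z) = Some (x, w) ->
  let f := dx_over_w_along g z in
  is_derive z 1 (@xC C k \o g) (f * w) /\
  is_derive z 1 (@wC C k \o g) (f * P^`().[x] / 2).
Proof.
move=> [cg dxw _] e; have h : xw (g z) by rewrite e.
have [/derivableP dx /derivableP dw] := dxw h.
move: dx dw; set dx := 'D_1 _ z; set dw := 'D_1 _ z => hx hw.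
have key : 2 * w * dw = P^`().[x] * dx.
  have d1 : is_derive z 1 (fun z => P.[xC (g z)]) (P^`().[x] * dx).
    by have := is_derive_horner P hx; rewrite /= (xCE e).
  have d2 : is_derive z 1 (fun z => 'X^2.[wC (g z)]) (2 * w * dw).
    have := is_derive_horner 'X^2 hw.
    by rewrite /= (wCE e) derivXn hornerMn hornerX mulr_natl.
  have d3 : is_derive z 1 (fun z => P.[xC (g z)]) (2 * w * dw).
    apply: near_is_derive d2; apply: filterS (near_xw cg h) => y ey.
    by rewrite hornerXn (xw_eq ey).
  by case: d1 => _ <-; case: d3 => _ <-.
rewrite /dx_over_w_along e; case: eqVneq => [w0|w0].
  have P0 : P^`().[x] != 0.
    by apply: deriv_legendre_neq0; rewrite -(xw_eq e) w0 expr0n.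
  have dx0 : dx = 0.
    by apply: (mulfI P0); rewrite -key w0 !(mulr0, mul0r).
  split; first by rewrite w0 mulr0 -dx0.
  by rewrite divfK // mulrAC mulfV ?pnatr_eq0 // mul1r.
split; first by rewrite divfK.
rewrite -/dx [dx / w * _]mulrAC [dx * _]mulrC -key.
by rewrite (_ : _ / 2 = dw) //; field.
Qed.

Lemma vC_inf_neq0 (p : curve) : xw p = None -> vC p != 0.
Proof.
move=> /xw_none[v e v2]; rewrite (vCE e); apply: contraNneq k0 => v0.
by rewrite -sqrf_eq0 -v2 v0 expr0n.
Qed.

Lemma is_derive_uv g z : hol_at g z -> xw (g z) = None ->
  is_derive z 1 (@uC C k \o g) (- (dx_over_w_along g z * vC (g z))).
Proof.
move=> [_ _ duv] e; have [v ev _] := xw_none e.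
have [/derivableP du _] : derivable (@uC C k \o g) z 1 /\ derivable (@vC C k \o g) z 1.
  by apply: duv; rewrite ev.
by rewrite /dx_over_w_along e divfK ?opprK ?vC_inf_neq0.
Qed.

(** The converse of [is_derive_xw]: the two equations determine y, because w and P'(x) are not both
    zero. *)
Lemma dx_over_w_along_xw g z x w y : xw (g z) = Some (x, w) ->
  is_derive z 1 (@xC C k \o g) (y * w) ->
  is_derive z 1 (@wC C k \o g) (y * P^`().[x] / 2) ->
  dx_over_w_along g z = y.
Proof.
move=> e [_ dx] [_ dw]; rewrite /dx_over_w_along e dx dw.
case: eqVneq => w0; last by rewrite mulfK.
have P0 : P^`().[x] != 0.
  by apply: deriv_legendre_neq0; rewrite -(xw_eq e) w0 expr0n.
by field.
Qed.

Lemma dx_over_w_along_inf g z y : xw (g z) = None ->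
  is_derive z 1 (@uC C k \o g) (- (y * vC (g z))) ->
  dx_over_w_along g z = y.
Proof.
by move=> e [_ du]; rewrite /dx_over_w_along e du opprK mulfK ?vC_inf_neq0.
Qed.

Lemma near_cimg (c : chart C (Sigma k)) z : cimg c z ->
  \near z, cdom c (cinv c z) /\ cmap c (cinv c z) = z.
Proof.
move=> h; have : \near z, cimg c z by apply: open_nbhs_nbhs; split=> //; exact: cimg_open.
by apply: filterS => y [p hp <-]; rewrite cmapK.
Qed.

(** In each kind of chart one coordinate of [cinv c] is the identity near z. The other one solves
    the equation of the curve, and [derivable_implicit] applies because the nonvanishing condition
    of the chart makes the relevant partial derivative nonzero. *)
Lemma hol_at_cinv c z : curve_atlas c -> cimg c z -> hol_at (cinv c) z.
Proof.
move=> hc hz; have n := near_cimg hz; have [hd hm] := nbhs_singleton n.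
have cc : {for z, continuous (cinv c)} by apply: cinv_cont.
have cdX2 (y : C) : 'X^2^`().[y] = 2 * y.
  by rewrite derivXn hornerMn hornerX mulr_natl.
case: hc => [hc|[hc|hc]]; have [h w0 m] := hc _ hd.
- have dx : derivable (@xC C k \o cinv c) z 1.
    apply: (@near_eq_derivable _ _ _ id); last exact: derivable_id.
    by apply: filterS n => y [hy e] /=; have [_ _ <-] := hc _ hy.
  apply: (hol_at_xw (near_xw cc h) dx _).
  apply: (@derivable_implicit _ 'X^2 _ (fun y => P.[xC (cinv c y)])).
  + by apply: continuous_comp => //; exact: continuous_wC.
  + by apply: filterS (near_xw cc h) => y e; rewrite hornerXn (xw_eq e).
  + by have [] := is_derive_horner P (derivableP dx).
  + by rewrite cdX2 mulf_neq0 ?pnatr_eq0.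
- have dw : derivable (@wC C k \o cinv c) z 1.
    apply: (@near_eq_derivable _ _ _ id); last exact: derivable_id.
    by apply: filterS n => y [hy e] /=; have [_ _ <-] := hc _ hy.
  apply: (hol_at_xw (near_xw cc h) _ dw).
  apply: (@derivable_implicit _ P _ (fun y => 'X^2.[wC (cinv c y)])).
  + by apply: continuous_comp => //; exact: continuous_xC.
  + by apply: filterS (near_xw cc h) => y e; rewrite hornerXn (xw_eq e).
  + by have [] := is_derive_horner 'X^2 (derivableP dw).
  + by [].
- have du : derivable (@uC C k \o cinv c) z 1.
    apply: (@near_eq_derivable _ _ _ id); last exact: derivable_id.
    by apply: filterS n => y [hy e] /=; have [_ _ <-] := hc _ hy.
  apply: (hol_at_uv (near_uv cc h) du _).
  apply: (@derivable_implicit _ 'X^2 _ (fun y => (legendre_inf k).[uC (cinv c y)])).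
  + by apply: continuous_comp => //; exact: continuous_vC.
  + by apply: filterS (near_uv cc h) => y e; rewrite hornerXn (uv_eq e).
  + by have [] := is_derive_horner (legendre_inf k) (derivableP du).
  + by rewrite cdX2 mulf_neq0 ?pnatr_eq0.
Qed.

Lemma near_cdom g d z : {for z, continuous g} -> cdom d (g z) ->
  \near z, cdom d (g z).
Proof.
by move=> cg h; apply: cg; apply: open_nbhs_nbhs; split=> //; exact: cdom_open.
Qed.

Lemma derivable_chart g d z : hol_at g z -> curve_atlas d -> cdom d (g z) ->
  derivable (cmap d \o g) z 1.
Proof.
move=> [cg dxw duv] hd h; have n := near_cdom cg h.
case: hd => [hd|[hd|hd]]; have [hp _ _] := hd _ h.
- have [dx _] := dxw hp; apply: near_eq_derivable dx.
  by apply: filterS n => y hy /=; have [_ _ ->] := hd _ hy.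
- have [_ dw] := dxw hp; apply: near_eq_derivable dw.
  by apply: filterS n => y hy /=; have [_ _ ->] := hd _ hy.
- have [du _] := duv hp; apply: near_eq_derivable du.
  by apply: filterS n => y hy /=; have [_ _ ->] := hd _ hy.
Qed.

(** Near z, g is the composite of [cinv d] with [cmap d \o g]. The chain rule multiplies the
    derivatives of the coordinates along [cinv d] by that of [cmap d \o g], and these derivatives
    determine the value of the form. *)
Lemma dx_over_w_along_chart g d z : hol_at g z -> curve_atlas d ->
  cdom d (g z) ->
  dx_over_w_along g z =
  dx_over_w_along (cinv d) (cmap d (g z)) * 'D_1 (cmap d \o g) z.
Proof.
move=> hg hd h; have [cg _ _] := hg.
have dm := derivableP (derivable_chart hg hd h).
have hc : hol_at (cinv d) (cmap d (g z)) by apply: hol_at_cinv => //; exists (g z).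
have e : \near z, g z = cinv d (cmap d (g z)).
  by apply: filterS (near_cdom cg h) => y hy; rewrite cmapK.
have ez : cinv d (cmap d (g z)) = g z by rewrite cmapK.
case exw : (xw (g z)) => [[x w]|].
  have [] := is_derive_xw (x := x) (w := w) hc; first by rewrite ez.
  move=> /is_derive_chain /(_ dm) dx /is_derive_chain /(_ dm) dw.
  apply: (dx_over_w_along_xw exw).
    rewrite mulrAC; apply: near_is_derive dx.
    by apply: filterS e => y /= <-.
  rewrite [_ * P^`().[x]]mulrAC [_ / 2]mulrAC; apply: near_is_derive dw.
  by apply: filterS e => y /= <-.
apply: dx_over_w_along_inf => //.
have /is_derive_chain /(_ dm) du := is_derive_uv hc (etrans (congr1 _ ez) exw).
rewrite ez mulNr mulrAC in du; apply: near_is_derive du.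
by apply: filterS e => y /= <-.
Qed.

End HolomorphicPaths.

(* Junk value [infty1] off the plane curve. *)
Definition curve_point {C : numClosedFieldType} (k : C) (z : C * C) : curve k :=
  if insub z : option {p : C * C | p.2 ^+ 2 == (legendre k).[p.1]} is Some q
  then inl q else infty1 k.

Lemma xw_curve_point {C : numClosedFieldType} (k : C) (z : C * C) :
  z.2 ^+ 2 = (legendre k).[z.1] -> xw (curve_point k z) = Some z.
Proof. by move=> /eqP h; rewrite /curve_point insubT. Qed.

(** * The map between the two curves *)

Section Isogeny.
Context {C : numClosedFieldType} {k k1 : C}.
Hypotheses (k0 : k != 0) (k21 : k ^+ 2 != 1) (kN1 : 1 + k != 0) (k1E : k1 = (1 - k) / (1 + k)).
Local Notation s := ('i * (1 + k)).

(** Where w = 0 one has x^2 = 1 or k^2 x^2 = 1, and the test on x^2 separates the two cases. The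
    junk value of [curve_point] is never reached, by [isogeny_xw] and [isogeny_inf]. *)
Definition isogeny (p : curve k) : curve k1 :=
  match p with
  | inl q => let: (x, w) := val q in
      if w == 0 then if x ^+ 2 == 1 then infty1 k1 else infty2 k1
      else curve_point k1 (s * (x / w), (k ^+ 2 * x ^+ 4 - 1) / w ^+ 2)
  | inr _ => curve_point k1 (0, 1)
  end.

Let s0 : s != 0. Proof. by rewrite mulf_neq0 ?neq0Ci. Qed.

Let s2 : s ^+ 2 = - (1 + k) ^+ 2.
Proof. by rewrite exprMn sqrCi mulN1r. Qed.

(** Both factors 1 - lambda^2 and 1 - k1^2 lambda^2 are squares divided by w^2, and the product of
    the squares is (1 - k^2 x^4)^2, so the image lies on the target curve. *)
Lemma isogeny_xw p x w : xw p = Some (x, w) -> w != 0 ->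
  xw (isogeny p) = Some (s * (x / w), (k ^+ 2 * x ^+ 4 - 1) / w ^+ 2).
Proof.
move=> e w0; have w2 := xw_eq e; rewrite legendreE in w2.
case: p e => // -[[x' w'] /= h] [? ?]; subst x' w'.
have l2 : (s * (x / w)) ^+ 2 = - (1 + k) ^+ 2 * (x ^+ 2 * w ^- 2).
  by rewrite exprMn s2 exprMn exprVn.
rewrite (negPf w0) xw_curve_point //= legendreE l2 k1E.
have -> : (1 - - (1 + k) ^+ 2 * (x ^+ 2 * w ^- 2)) =
    (1 + k * x ^+ 2) ^+ 2 / w ^+ 2.
  have -> : (1 + k * x ^+ 2) ^+ 2 = w ^+ 2 + (1 + k) ^+ 2 * x ^+ 2.
    by rewrite w2; ring.
  by field.
have -> : (1 - ((1 - k) / (1 + k)) ^+ 2 * (- (1 + k) ^+ 2 * (x ^+ 2 * w ^- 2))) =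
    (1 - k * x ^+ 2) ^+ 2 / w ^+ 2.
  have -> : (1 - k * x ^+ 2) ^+ 2 = w ^+ 2 + (1 - k) ^+ 2 * x ^+ 2.
    by rewrite w2; ring.
  by field; rewrite w0 kN1.
by field.
Qed.

Lemma isogeny_inf p : xw p = None -> xw (isogeny p) = Some (0, 1).
Proof.
case: p => //= b _; rewrite xw_curve_point //= legendreE.
by rewrite !expr0n /= mulr0 !subr0 mulr1 expr1n.
Qed.

Lemma isogeny_uv_xw p u v : uv p = Some (u, v) -> v != 0 ->
  xw (isogeny p) = Some (s * (u / v), (k ^+ 2 - u ^+ 4) / v ^+ 2).
Proof.
move=> e v0; have [u0|u0] := eqVneq u 0.
  rewrite isogeny_inf; last first.
    case: p e => //= -[[x w] /= _]; case: eqVneq => // x0 [/eqP].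
    by rewrite u0 invr_eq0 (negPf x0).
  have -> : v ^+ 2 = k ^+ 2 by rewrite (uv_eq e) legendre_infE u0; ring.
  by rewrite u0 mul0r mulr0 expr0n subr0 mulfV // expf_neq0.
rewrite (isogeny_xw (uv_xw e u0)); last by rewrite mulf_neq0 ?invr_eq0 ?expf_neq0.
by congr (Some (_, _)); field; rewrite ?u0 ?v0.
Qed.

Lemma isogeny_branch p x w : xw p = Some (x, w) -> w = 0 ->
  isogeny p = if x ^+ 2 == 1 then infty1 k1 else infty2 k1.
Proof. by case: p => // -[[x' w'] /= h] [-> ->] ->; rewrite eqxx. Qed.

Lemma isogeny_uv p x w : xw p = Some (x, w) -> x != 0 ->
  uv (isogeny p) = Some (w / (s * x), (1 - k ^+ 2 * x ^+ 4) / ((1 + k) ^+ 2 * x ^+ 2)).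
Proof.
move=> e x0; have [w0|w0] := eqVneq w 0.
  rewrite (isogeny_branch e w0) w0 mul0r.
  have := xw_eq e; rewrite legendreE w0 expr0n /= => /esym/eqP.
  rewrite mulf_eq0 !subr_eq0 ![1 == _]eq_sym k1E.
  have -> : x ^+ 4 = (x ^+ 2) ^+ 2 by rewrite -exprM.
  (* The formula for mu/lambda^2 gives (1 - k^2)/(1 + k)^2 = k1 at x^2 = 1 and the opposite value at
     x^2 = 1/k^2, which are the second coordinates of [infty1 k1] and [infty2 k1]. *)
  case: eqVneq => [x21 _|_ /= /eqP x21] /=; congr (Some (_, _)).
    by rewrite x21; field; rewrite kN1.
  have -> : x ^+ 2 = (k ^+ 2)^-1.
    by rewrite -[RHS]mulr1 -x21 mulKf // expf_neq0.
  by field; rewrite kN1 k0.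
have l0 : s * (x / w) != 0 := mulf_neq0 s0 (mulf_neq0 x0 (invr_neq0 w0)).
rewrite (xw_uv (isogeny_xw e w0) l0).
congr (Some (_, _)); first by rewrite -[in RHS]invf_div mulrA.
by rewrite exprMn s2; field; rewrite x0 w0 kN1.
Qed.

(** Three formulas cover the curve: (u, v) to (lambda, mu) at infinity, (x, w) to (1/lambda,
    mu/lambda^2) at w = 0, and (x, w) to (lambda, mu) elsewhere. *)
Lemma isogeny_continuous : continuous isogeny.
Proof.
move=> p.
case exw : (xw p) => [[x w]|]; last first.
  have [v ev _] := xw_none exw; have h : uv p by rewrite ev.
  have v0 : vC p != 0 by exact: vC_inf_neq0.
  have n0 : \forall q \near p, vC q != 0 by exact: (cvgr_neq0 _ (continuous_vC h)).
  (* Taken at the identity map, [near_uv] says that the patch is a neighbourhood of p. *)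
  have nq := near_uv (g := id) (fun _ => id) h.
  apply: (@continuous_xw _ _ _ _ _ (fun q => s * (uC q / vC q))
           (fun q => ((k ^+ 2)%:P - 'X^4).[uC q] / 'X^2.[vC q])).
  - near=> q; rewrite !(hornerXn, hornerD, hornerN, hornerM, hornerC).
    by apply: isogeny_uv_xw; near: q.
  - by apply: continuous_Ml; apply: continuous_div => //;
      [exact: continuous_uC|exact: continuous_vC].
  - apply: continuous_div; last by rewrite hornerXn expf_neq0.
      by apply: continuous_horner_comp; exact: continuous_uC.
    by apply: continuous_horner_comp; exact: continuous_vC.
have h : xw p by rewrite exw.
have nq := near_xw (g := id) (fun _ => id) h.
have [w0|w0] := eqVneq (wC p) 0.
  have x0 : xC p != 0.
    apply/eqP => x0; have := xw_eq (xwE h); rewrite legendreE x0 w0 !expr0n /=.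
    by rewrite mulr0 !subr0 mulr1 => /esym/eqP; rewrite oner_eq0.
  have n0 : \forall q \near p, xC q != 0 by exact: (cvgr_neq0 _ (continuous_xC h)).
  apply: (@continuous_uv _ _ _ _ _ (fun q => wC q / (s * xC q))
           (fun q => (1%:P - (k ^+ 2)%:P * 'X^4).[xC q] / ((1 + k) ^+ 2 * 'X^2.[xC q]))).
  - near=> q; rewrite !(hornerXn, hornerD, hornerN, hornerM, hornerC).
    by apply: isogeny_uv; near: q.
  - apply: continuous_div; last by rewrite mulf_neq0.
      exact: continuous_wC.
    by apply: continuous_Ml; exact: continuous_xC.
  - apply: continuous_div; last by rewrite hornerXn mulf_neq0 ?expf_neq0.
      by apply: continuous_horner_comp; exact: continuous_xC.
    by apply: continuous_Ml; apply: continuous_horner_comp; exact: continuous_xC.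
have n0 : \forall q \near p, wC q != 0 by exact: (cvgr_neq0 _ (continuous_wC h)).
apply: (@continuous_xw _ _ _ _ _ (fun q => s * (xC q / wC q))
         (fun q => ((k ^+ 2)%:P * 'X^4 - 1%:P).[xC q] / 'X^2.[wC q])).
- near=> q; rewrite !(hornerXn, hornerD, hornerN, hornerM, hornerC).
  by apply: isogeny_xw; near: q.
- by apply: continuous_Ml; apply: continuous_div => //;
    [exact: continuous_xC|exact: continuous_wC].
- apply: continuous_div; last by rewrite hornerXn expf_neq0.
    by apply: continuous_horner_comp; exact: continuous_xC.
  by apply: continuous_horner_comp; exact: continuous_wC.
Unshelve. all: by end_near.
Qed.

(** With the next fact, the target modulus satisfies the same nondegeneracy as [k], so the results
    on dx/w apply to the target curve too. *)
Let k1_neq0 : k1 != 0.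
Proof.
rewrite k1E mulf_neq0 ?invr_eq0 // subr_eq0 eq_sym.
by apply: contraNneq k21 => ->; rewrite expr1n.
Qed.

Let k1_sq_neq1 : k1 ^+ 2 != 1.
Proof.
rewrite k1E -subr_eq0.
have -> : ((1 - k) / (1 + k)) ^+ 2 - 1 = - 4 * k / (1 + k) ^+ 2 by field.
by rewrite !mulf_neq0 ?invr_eq0 ?expf_neq0 ?oppr_eq0 ?pnatr_eq0.
Qed.

(** Both holomorphy and the pullback formula come from this lemma at [g := cinv c]. The cases are
    those of [isogeny_continuous]. *)
Lemma isogeny_pullback (g : C -> curve k) z : hol_at g z ->
  hol_at (isogeny \o g) z /\
  dx_over_w_along (isogeny \o g) z = - s * dx_over_w_along g z.
Proof.
move=> hg; have [cg _ duv] := hg; set f := dx_over_w_along g z.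
case exw : (xw (g z)) => [[x w]|]; last first.
  have [v ev _] := xw_none exw; have h : uv (g z) by rewrite ev.
  have v0 : vC (g z) != 0 by exact: vC_inf_neq0.
  have du := is_derive_uv k0 hg exw.
  have [_ dv'] := duv h; have dv := derivableP dv'.
  have n0 : \forall y \near z, vC (g y) != 0.
    by apply: (cvgr_neq0 _ (derivable1_continuous dv')).
  have nq := near_uv cg h.
  have e : \forall y \near z, xw (isogeny (g y)) =
      Some (s * (uC (g y) / vC (g y)),
            ((k ^+ 2)%:P - 'X^4).[uC (g y)] / 'X^2.[vC (g y)]).
    near=> y; rewrite !(hornerXn, hornerD, hornerN, hornerM, hornerC).
    by apply: isogeny_uv_xw; near: y.
  have v20 : 'X^2.[vC (g z)] != 0 by rewrite hornerXn expf_neq0.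
  have dl := is_derive_Ml s (is_derive_div du dv v0).
  have [dm _] := is_derive_div (is_derive_horner ((k ^+ 2)%:P - 'X^4) du)
    (is_derive_horner 'X^2 dv) v20.
  have hh : hol_at (isogeny \o g) z by apply: (hol_at_xw e) => //; case: dl.
  (* Here u = 0 and mu = 1, so the value is lambda' = s u' / v with u' = - f v, that is - s f. *)
  split=> //; rewrite /dx_over_w_along (isogeny_inf exw) oner_eq0 divr1.
  rewrite -/f in dl.
  have -> : 'D_1 (@xC C k1 \o (isogeny \o g)) z = 'D_1 (fun y => s * (uC (g y) / vC (g y))) z.
    by apply: near_eq_derive; apply: filterS e => y ey /=; rewrite (xCE ey).
  case: dl => _ ->; rewrite /= (uCE ev) mul0r subr0; field.
  exact: v0.
have h : xw (g z) by rewrite exw.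
have nq := near_xw cg h.
have [] := is_derive_xw k21 hg exw; rewrite -/f => dx dw.
have xE := xCE exw; have wE := wCE exw.
have w2 := xw_eq exw; rewrite legendreE in w2.
have [w0|w0] := eqVneq w 0.
  have x0 : x != 0.
    apply/eqP => x0; have /eqP := w2; rewrite x0 w0 !expr0n /=.
    by rewrite mulr0 !subr0 mulr1 eq_sym oner_eq0.
  have n0 : \forall y \near z, xC (g y) != 0.
    by case: dx => dx _; apply: (cvgr_neq0 _ (derivable1_continuous dx)); rewrite /= xE.
  have e : \forall y \near z, uv (isogeny (g y)) =
      Some (wC (g y) / (s * xC (g y)),
            (1%:P - (k ^+ 2)%:P * 'X^4).[xC (g y)] / ((1 + k) ^+ 2 * 'X^2.[xC (g y)])).
    near=> y; rewrite !(hornerXn, hornerD, hornerN, hornerM, hornerC).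
    by apply: isogeny_uv; near: y.
  have sx0 : s * xC (g z) != 0 by rewrite xE mulf_neq0.
  have sx20 : (1 + k) ^+ 2 * 'X^2.[xC (g z)] != 0.
    by rewrite xE hornerXn mulf_neq0 ?expf_neq0.
  have du := is_derive_div dw (is_derive_Ml s dx) sx0.
  have [dv _] := is_derive_div (is_derive_horner (1%:P - (k ^+ 2)%:P * 'X^4) dx)
    (is_derive_Ml ((1 + k) ^+ 2) (is_derive_horner 'X^2 dx)) sx20.
  have hh : hol_at (isogeny \o g) z by apply: (hol_at_uv e) => //; case: du.
  split=> //; apply: (dx_over_w_along_inf k1_neq0).
    by rewrite /= (isogeny_branch exw w0); case: ifP.
  have -> : vC ((isogeny \o g) z) = (1 - k ^+ 2 * x ^+ 4) / ((1 + k) ^+ 2 * x ^+ 2).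
    exact: vCE (isogeny_uv exw x0).
  apply: is_derive_eq.
    apply: near_is_derive du; apply: filterS e => y ey /=.
    by rewrite (uCE ey).
  rewrite /= xE wE w0 deriv_legendreE.
  (* The left side is x P'(x) / 2. It differs from the right side by P(x), which is zero here. *)
  have W : x ^+ 2 * (2 * k ^+ 2 * x ^+ 2 - 1 - k ^+ 2) = k ^+ 2 * x ^+ 4 - 1.
    transitivity (k ^+ 2 * x ^+ 4 - 1 + (1 - x ^+ 2) * (1 - k ^+ 2 * x ^+ 2)).
      by ring.
    by rewrite -w2 w0; ring.
  have -> : (1 + k) ^+ 2 = - s ^+ 2 by rewrite s2 opprK.
  transitivity (f * (x ^+ 2 * (2 * k ^+ 2 * x ^+ 2 - 1 - k ^+ 2)) / (s * x ^+ 2)).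
    by field; rewrite x0 kN1 neq0Ci.
  by rewrite W; field; rewrite x0 kN1 neq0Ci.
have n0 : \forall y \near z, wC (g y) != 0.
  by case: dw => dw _; apply: (cvgr_neq0 _ (derivable1_continuous dw)); rewrite /= wE.
have e : \forall y \near z, xw (isogeny (g y)) =
    Some (s * (xC (g y) / wC (g y)),
          ((k ^+ 2)%:P * 'X^4 - 1%:P).[xC (g y)] / 'X^2.[wC (g y)]).
  near=> y; rewrite !(hornerXn, hornerD, hornerN, hornerM, hornerC).
  by apply: isogeny_xw; near: y.
have wz0 : wC (g z) != 0 by rewrite wE.
have w20 : 'X^2.[wC (g z)] != 0 by rewrite hornerXn expf_neq0.
have dl := is_derive_Ml s (is_derive_div dx dw wz0).
have dm := is_derive_div (is_derive_horner ((k ^+ 2)%:P * 'X^4 - 1%:P) dx)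
    (is_derive_horner 'X^2 dw) w20.
have hh : hol_at (isogeny \o g) z.
  by apply: (hol_at_xw e); [case: dl|case: dm].
have exw' : xw ((isogeny \o g) z) = Some (s * (x / w), (k ^+ 2 * x ^+ 4 - 1) / w ^+ 2).
  exact: isogeny_xw exw w0.
(* Since mu may vanish, where k^2 x^4 = 1, both equations are checked: lambda' = - s f mu, then mu'
   = - s f P1'(lambda) / 2, with P1 the quartic of modulus k1. *)
split=> //; apply: (dx_over_w_along_xw k1_sq_neq1 exw').
  apply: is_derive_eq.
    apply: near_is_derive dl; apply: filterS e => y ey /=.
    by rewrite (xCE ey).
  rewrite /= xE wE deriv_legendreE.
  transitivity (s * f * (w ^+ 2 - x ^+ 2 * (2 * k ^+ 2 * x ^+ 2 - 1 - k ^+ 2)) / w ^+ 2).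
    by field.
  by rewrite {1}w2; field.
apply: is_derive_eq.
  apply: near_is_derive dm; apply: filterS e => y ey /=.
  by rewrite (wCE ey).
rewrite /= xE wE !deriv_legendreE.
have -> : ((k ^+ 2)%:P * 'X^4 - 1%:P)^`().[x] = 4 * k ^+ 2 * x ^+ 3.
  by rewrite derivB derivC subr0 derivM derivC derivXn !hornerE /=; ring.
rewrite derivXn hornerMn !(hornerXn, hornerD, hornerN, hornerM, hornerC) /=.
transitivity (f * (4 * k ^+ 2 * x ^+ 3 * w ^+ 2 -
    (k ^+ 2 * x ^+ 4 - 1) * (2 * x * (2 * k ^+ 2 * x ^+ 2 - 1 - k ^+ 2))) / w ^+ 3).
  by field.
(* The target is a polynomial in x/w, so the numerator is rewritten modulo w^2 = P(x) as x times a
   quadratic form in x and w. Its coefficients come from s^2 (1 + k1^2) = - 2 (1 + k^2) and s^4 k1^2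
   = (1 - k^2)^2. *)
transitivity (f * (- 2 * x * ((1 + k ^+ 2) * w ^+ 2 + (1 - k ^+ 2) ^+ 2 * x ^+ 2)) / w ^+ 3).
  by congr (_ * _ / _); rewrite w2; ring.
transitivity (- s ^+ 2 * f * (x / w) *
    (2 * k1 ^+ 2 * (s ^+ 2 * (x / w) ^+ 2) - 1 - k1 ^+ 2)).
  by rewrite s2 k1E; field; rewrite w0 kN1.
by field.
Unshelve. all: by end_near.
Qed.

Lemma isogeny_holomorphic : @holomorphic C (Sigma k) (Sigma k1) isogeny.
Proof.
split; first exact: isogeny_continuous.
move=> c d z hc hd hz h.
have [hg _] := isogeny_pullback (hol_at_cinv hc hz).
exact: (derivable_chart hg hd h).
Qed.

Lemma isogeny_is_pullback : @is_pullback C (Sigma k) (Sigma k1) isogeny (@dx_over_w C k1)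
  (scale_form (- s) (@dx_over_w C k)).
Proof.
move=> c d z hc hd hz h.
have [hg e] := isogeny_pullback (hol_at_cinv hc hz).
exact: etrans (esym e) (dx_over_w_along_chart k1_neq0 k1_sq_neq1 hg hd h).
Qed.

End Isogeny.

(** * The moduli attached to a, A and B, and the four claims *)

Unset Implicit Arguments.

Theorem proposition4p2 (R : realType)
  (a A B b d x1 x2 l1 l2 k k1 : Cplx R)
  (ha : a != 0) (hB : B != 0) (hAB : A ^+ 2 != 4 * a ^+ 2 * B)
  (hb : b ^+ 2 = B) (hd : d ^+ 2 = A ^+ 2 - 4 * a ^+ 2 * B)
  (hp : forall x : Cplx R,
     x ^+ 4 - 2 * A * x ^+ 2 + A ^+ 2 - 4 * a ^+ 2 * B = 0 <->
     x \in [:: x1; - x1; x2; - x2])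
  (hx1 : x1 ^+ 2 = A + 2 * a * b) (hx2 : x2 ^+ 2 = A - 2 * a * b)
  (hp1 : forall l : Cplx R,
     a ^+ 2 * l ^+ 4 - A * l ^+ 2 + B = 0 <->
     l \in [:: l1; - l1; l2; - l2])
  (hl1 : l1 ^+ 2 = (A + d) / (2 * a ^+ 2))
  (hl2 : l2 ^+ 2 = (A - d) / (2 * a ^+ 2))
  (hl1x : l1 = (x2 - x1) / (2 * a)) (hl2x : l2 = (x1 + x2) / (2 * a))
  (hk : k = x1 / x2) (hk1 : k1 = l1 / l2) :
  k1 = (1 - k) / (1 + k) /\
  exists phi : Sigma k -> Sigma k1,
    [/\ (* (ii) *)
        holomorphic phi /\
        (forall p x w, xw p = Some (x, w) -> w != 0 ->
           xw (phi p) = Some ('i * (1 + k) * (x / w),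
                              (k ^+ 2 * x ^+ 4 - 1) / w ^+ 2)),
        (* (iii) *)
        [/\ (forall p, p = infty1 k \/ p = infty2 k ->
               xw (phi p) = Some (0, 1)),
            (forall p, xw p = Some (0, 1) \/ xw p = Some (0, -1) ->
               xw (phi p) = Some (0, -1)),
            (forall p, xw p = Some (1, 0) \/ xw p = Some (-1, 0) ->
               phi p = infty1 k1) &
            (forall p, xw p = Some (k^-1, 0) \/ xw p = Some (- k^-1, 0) ->
               phi p = infty2 k1)] &
        (* (iv) *)
        is_pullback phi (@dx_over_w _ k1)
          (scale_form (- ('i * (1 + k))) (@dx_over_w _ k))].
Proof.
have b0 : b != 0 by apply: contraNneq hB => b0; rewrite -hb b0 expr0n.
(* Nondegeneracy of k comes from x1^2 x2^2 = A^2 - 4 a^2 B, which gives k <> 0, and from x1^2 - x2^2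
   = 4 a b, which gives k^2 <> 1. *)
have x120 : x1 ^+ 2 * x2 ^+ 2 != 0.
  rewrite hx1 hx2.
  have -> : (A + 2 * a * b) * (A - 2 * a * b) = A ^+ 2 - 4 * a ^+ 2 * B.
    by rewrite -hb; ring.
  by rewrite subr_eq0.
have x10 : x1 != 0 by apply: contraNneq x120 => ->; rewrite expr0n mul0r.
have x20 : x2 != 0 by apply: contraNneq x120 => ->; rewrite expr0n mulr0.
have k0 : k != 0 by rewrite hk mulf_neq0 ?invr_eq0.
have k21 : k ^+ 2 != 1.
  have h : x1 ^+ 2 - x2 ^+ 2 != 0.
    have -> : x1 ^+ 2 - x2 ^+ 2 = 4 * a * b by rewrite hx1 hx2; ring.
    by rewrite !mulf_neq0 ?pnatr_eq0.
  apply: contraNneq h => e; rewrite subr_eq0; apply/eqP.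
  by rewrite -[RHS]mul1r -e hk; field.
have kN1 : 1 + k != 0.
  apply: contraNneq k21 => e.
  have -> : k ^+ 2 = 1 + (1 + k) * (k - 1) by ring.
  by rewrite e mul0r addr0.
have x120' : x1 + x2 != 0.
  apply: contraNneq kN1 => e.
  have -> : 1 + k = (x1 + x2) / x2 by rewrite hk; field.
  by rewrite e mul0r.
have k1E : k1 = (1 - k) / (1 + k).
  rewrite hk1 hl1x hl2x hk; field.
  by rewrite x20 addrC x120' ha.
split=> //; exists (isogeny (k := k) (k1 := k1)); split.
- split; first exact: isogeny_holomorphic.
  exact: isogeny_xw.
- split.
  + by move=> p hp'; apply: isogeny_inf; case: hp' => ->.
  + move=> p [] e; rewrite (isogeny_xw kN1 k1E e) ?oppr_eq0 ?oner_eq0 //;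
      by rewrite ?sqrrN expr1n mul0r mulr0 expr0n mulr0 sub0r divr1.
  + by move=> p [] /isogeny_branch -> //; rewrite ?sqrrN expr1n eqxx.
  (* At x = 1/k or - 1/k the test x^2 = 1 in [isogeny] amounts to k^2 = 1, hence fails. *)
  + by move=> p [] /isogeny_branch -> //;
      rewrite ?sqrrN exprVn invr_eq1 (negPf k21).
- exact: isogeny_is_pullback.
Qed.
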